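(* Let $k$ be a positive integer. Then for every $a>0$ there exists $c>0$ with the following property. Let $H$ be a $(k+1)$-partite $k$-uniform hypergraph with (finite) vertex sets $X_1,\dots,X_{k+1}$, and let $N_i$ be the size of $X_i$. Suppose that $H$ contains at most $c\prod_{i=1}^{k+1}N_i$ simplices. Then for each $i\le k+1$ one can remove at most $a\prod_{j\ne i}N_j$ edges of $H$ from $\prod_{j\ne i}X_j$ in such a way that after the removals (for all $i$) one is left with a hypergraph that is simplex-free.
   Context: A $(k+1)$-partite $k$-uniform hypergraph with vertex sets $X_1,\dots,X_{k+1}$ (disjoint finite sets) is a collection $H$ of $k$-element subsets $A$ of $X_1\cup\dots\cup X_{k+1}$ (the edges) such that $|A\cap X_i|\le 1$ for every $i$. An edge disjoint from $X_i$ meets every $X_j$ with $j\neq i$ in exactly one point and is identified with an element of $\prod_{j\ne i}X_j$. A simplex in $H$ is a sequence $(x_1,\dots,x_{k+1})\in X_1\times\dots\times X_{k+1}$ such that all $k+1$ of the $k$-element subsets of $\{x_1,\dots,x_{k+1}\}$ are edges of $H$. $H$ is simplex-free if it contains no simplex. *)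

(* Defs.v *)
From mathcomp Require Import all_boot.

Set Implicit Arguments.
Unset Strict Implicit.
Unset Printing Implicit Defensive.

(* The vertex classes are subsets of an ambient finite type T, indexed by
   'I_k.+1; points of T outside all the classes play no role. *)
Definition disjoint_classes (k : nat) (T : finType) (X : 'I_k.+1 -> {set T}) :=
  forall i j : 'I_k.+1, i != j -> [disjoint X i & X j].

Definition partite_hypergraph (k : nat) (T : finType)
    (X : 'I_k.+1 -> {set T}) (H : {set {set T}}) :=
  forall A : {set T}, A \in H ->
    [/\ A \subset \bigcup_(i < k.+1) X i,
        #|A| = k &
        forall i : 'I_k.+1, #|A :&: X i| <= 1].

(* For a partite hypergraph H with disjoint classes, each of these edges meets
   every X j with j != i in exactly one point, so this is the part of H lying
   in the product of the X j, j != i. *)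
Definition edges_missing (k : nat) (T : finType) (X : 'I_k.+1 -> {set T})
    (H : {set {set T}}) (i : 'I_k.+1) : {set {set T}} :=
  [set A in H | [disjoint A & X i]].

Definition is_simplex (k : nat) (T : finType) (X : 'I_k.+1 -> {set T})
    (H : {set {set T}}) (x : {ffun 'I_k.+1 -> T}) : bool :=
  [forall i, x i \in X i] &&
  [forall A : {set T},
     (A \subset [set x i | i : 'I_k.+1]) && (#|A| == k) ==> (A \in H)].

Definition simplices (k : nat) (T : finType) (X : 'I_k.+1 -> {set T})
    (H : {set {set T}}) : {set {ffun 'I_k.+1 -> T}} :=
  [set x | is_simplex X H x].

Definition simplex_free (k : nat) (T : finType) (X : 'I_k.+1 -> {set T})
    (H : {set {set T}}) :=
  forall x : {ffun 'I_k.+1 -> T}, ~~ is_simplex X H x.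

(* Main.v *)
Require Import Defs.
From mathcomp Require Import all_boot all_order all_algebra.
From mathcomp Require Import reals.
From mathcomp Require Import boolp ring lra.

Import Order.TTheory GRing.Theory Num.Theory.
Local Open Scope ring_scope.

(** Why the theorem is true.

Put independent uniform random points [x i] in the classes. For a set [e] of
indices let an [e]-event be an event that depends on the coordinates in [e]
only. Having edge [x_j, j <> i] in [H] is a [k]-coordinate event, and a small
number of simplices says that the intersection of these events is improbable.
The theorem is a removal statement: the events can be shrunk a little,
remaining events of the same coordinates, so that their intersection becomes
empty.

The removal statement [removal d j] is proved by induction on [j]. It concerns
[e]-events [Ev e], one for each [e] with at most [d] elements, whose
intersection is improbable, and which contain most of simple events [U e]:
those described by finitely many labels on at most [j] coordinates inside [e].
It produces small [e]-subevents to be removed from the [U e] so as to leave an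
empty intersection. The crucial point is the order of the quantifiers: how
well [Ev e] has to fill [U e] must be decided before the number [M] of labels
is known, while the bound on the probability of the intersection may depend on
[M]. For [j = 0] the [U e] are trivial events and there is nothing to remove.
For [j = d] one takes [U = Ev], the value of the event itself being the label.

For the step from [j] to [j.+1], cut the space into boxes by fixing all labels
[nu] on at most [j.+1] coordinates. In each box the labels on exactly [j.+1]
coordinates are integrated out: one keeps, for each [e], those points where,
conditionally on labels on at most [j] coordinates, the box has a
non-negligible probability and [Ev e] fills nearly all of it. This is a family
of [e]-events for level [j], and it has to be shown that

- the intersection of these events is improbable ([counting]), and
- they contain most of simple events of level [j] which themselves cover most
  of [U e] inside the boxes.

These two demands are conflicting, since the first asks for labels so fine that
they leave only a pseudorandom remainder ([pseudorandom]), and the second for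
few labels. Hence two systems of labels are used: a coarse system, with number
of labels under control, and a fine refinement of it, pseudorandom to a degree
that depends on the number of coarse labels. Energy increment
([regular_refinement]) gives both of them, with the corresponding conditional
probabilities close in mean square; the events are defined by the fine system,
and the simple events by the coarse one, with slightly stronger inequalities.

In [counting], pseudorandomness allows the indicators of the labels on [j.+1]
coordinates to be replaced one at a time by their conditional probabilities
([replace_factors]). The events [~ Ev e] take part in this as well: inside
the box and over the points that were kept, [~ Ev e] has relative probability
at most [1 / 2N], where [N] is the number of sets of indices; so half of the box
over these points lies in all [Ev e], hence is improbable, and since the box
is nowhere negligible over these points, so are the points themselves. *)

Set Implicit Arguments.
Unset Strict Implicit.
Unset Printing Implicit Defensive.

(** * Product probability spaces and conditional expectation *)

Section ProductSpace.
Variables (R : realFieldType) (I T : finType).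
Implicit Types (x y : {ffun I -> T}) (e : {set I}) (f g : {ffun I -> T} -> R).

Definition depends_on (A : Type) e (f : {ffun I -> T} -> A) :=
  forall x y, {in e, x =1 y} -> f x = f y.

Definition splice e x y : {ffun I -> T} :=
  [ffun i => if i \in e then x i else y i].

Lemma spliceC e x y :
  (splice e (splice e x y) (splice e y x) = x) *
  (splice e (splice e y x) (splice e x y) = y).
Proof. by split; apply/ffunP => i; rewrite !ffunE; case: (i \in e). Qed.

Definition prob_weights (w : I -> T -> R) :=
  (forall i t, 0 <= w i t) /\ (forall i, \sum_t w i t = 1).

Variable w : I -> T -> R.
Hypothesis wP : prob_weights w.

Definition weight x := \prod_i w i (x i).
Definition Ex f := \sum_x weight x * f x.
Definition Pr (b : {ffun I -> T} -> bool) := Ex (fun x => (b x)%:R).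

Lemma weight_ge0 x : 0 <= weight x.
Proof. by apply: prodr_ge0 => i _; apply: wP.1. Qed.

Lemma eq_Ex f g : f =1 g -> Ex f = Ex g.
Proof. by move=> fg; apply: eq_bigr => x _; rewrite fg. Qed.

Lemma le_Ex f g : (forall x, f x <= g x) -> Ex f <= Ex g.
Proof. by move=> fg; apply: ler_sum => x _; rewrite ler_wpM2l ?weight_ge0. Qed.

Lemma Ex_ge0 f : (forall x, 0 <= f x) -> 0 <= Ex f.
Proof. by move=> f0; apply: sumr_ge0 => x _; rewrite mulr_ge0 ?weight_ge0. Qed.

Lemma ExD f g : Ex (fun x => f x + g x) = Ex f + Ex g.
Proof. by rewrite -big_split; apply: eq_bigr => x _; rewrite mulrDr. Qed.

Lemma ExZ c f : Ex (fun x => c * f x) = c * Ex f.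
Proof. by rewrite mulr_sumr; apply: eq_bigr => x _; rewrite mulrCA. Qed.

Lemma ExB f g : Ex (fun x => f x - g x) = Ex f - Ex g.
Proof. by rewrite -sumrB; apply: eq_bigr => x _; rewrite mulrBr. Qed.

Lemma Ex_sum (J : finType) (P : pred J) (F : J -> {ffun I -> T} -> R) :
  Ex (fun x => \sum_(j | P j) F j x) = \sum_(j | P j) Ex (F j).
Proof. by rewrite exchange_big; apply: eq_bigr => x _; rewrite mulr_sumr. Qed.

Lemma sum_weight : \sum_x weight x = 1.
Proof.
rewrite -(bigA_distr_bigA (fun i t => w i t)).
by rewrite big1 // => i _; rewrite wP.2.
Qed.

Lemma Ex_cst c : Ex (fun=> c) = c.
Proof. by rewrite /Ex -mulr_suml sum_weight mul1r. Qed.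

Lemma ler_norm_Ex f : `|Ex f| <= Ex (fun x => `|f x|).
Proof.
apply: le_trans (ler_norm_sum _ _ _) _; apply: ler_sum => x _.
by rewrite normrM (ger0_norm (weight_ge0 x)).
Qed.

Lemma Pr_ge0 (b : {ffun I -> T} -> bool) : 0 <= Pr b.
Proof. by apply: Ex_ge0 => x; rewrite ler0n. Qed.

Lemma le_Pr (b c : {ffun I -> T} -> bool) : (forall x, b x -> c x) -> Pr b <= Pr c.
Proof.
move=> bc; apply: le_Ex => x; rewrite ler_nat.
by case: (b x) (bc x) => // ->.
Qed.

Lemma Pr_or (b c : {ffun I -> T} -> bool) : Pr (fun x => b x || c x) <= Pr b + Pr c.
Proof.
by rewrite -ExD; apply: le_Ex => x; case: (b x); case: (c x); rewrite -natrD ler_nat.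
Qed.

Lemma Pr_exists (J : finType) (P : pred J) (b : J -> {ffun I -> T} -> bool) :
  Pr (fun x => [exists j, P j && b j x]) <= \sum_(j | P j) Pr (b j).
Proof.
rewrite -Ex_sum; apply: le_Ex => x.
case: existsP => [[j /andP[Pj bj]]|_]; last by apply: sumr_ge0 => j _; rewrite ler0n.
rewrite (bigD1 j) //= bj lerDl; apply: sumr_ge0 => i _; exact: ler0n.
Qed.

Lemma chebyshev f c : 0 < c -> Pr (fun x => c <= `|f x|) <= Ex (fun x => f x ^+ 2) / c ^+ 2.
Proof.
move=> c0; rewrite mulrC -ExZ; apply: le_Ex => x.
have c20 : 0 < c ^+ 2 by rewrite exprn_gt0.
have [cf|_] := leP c; last by rewrite mulr_ge0 ?invr_ge0 ?sqr_ge0.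
by rewrite mulrC ler_pdivlMr // mul1r -[leRHS]real_normK ?num_real // lerXn2r ?nnegrE // ltW.
Qed.

(** Swapping coordinates between two independent samples preserves their joint
law. This form of Fubini's theorem is the only place where the product structure
of the weight enters. *)
Lemma Ex_splice e f : Ex f = Ex (fun y => Ex (fun x => f (splice e x y))).
Proof.
have Exx (F : {ffun I -> T} -> {ffun I -> T} -> R) :
    Ex (fun y => Ex (fun x => F x y)) = \sum_p weight p.1 * weight p.2 * F p.1 p.2.
  rewrite -(pair_bigA _ (fun x y => weight x * weight y * F x y)) exchange_big.
  apply: eq_bigr => y _; rewrite mulr_sumr; apply: eq_bigr => x _ /=.
  by rewrite mulrCA mulrA.
rewrite Exx; transitivity (Ex (fun y => Ex (fun x => f x))); first by rewrite Ex_cst.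
rewrite Exx (reindex (fun p => (splice e p.1 p.2, splice e p.2 p.1))) /=.
  apply: eq_bigr => -[x y] _ /=; congr (_ * _); rewrite /weight -!big_split /=.
  by apply: eq_bigr => i _; rewrite !ffunE; case: ifP => // _; rewrite mulrC.
exists (fun p => (splice e p.1 p.2, splice e p.2 p.1)) => -[x y] _ /=;
  by rewrite !spliceC.
Qed.

Definition measurable_for (L : eqType) (q : {ffun I -> T} -> L) (A : Type)
  (f : {ffun I -> T} -> A) := forall x y, q x = q y -> f x = f y.

(** On a fibre of weight zero the quotient is [0], which is harmless since such
points do not contribute to any expectation. *)
Definition cE (L : eqType) (q : {ffun I -> T} -> L) f x :=
  (\sum_(y | q y == q x) weight y * f y) / \sum_(y | q y == q x) weight y.

Section ConditionalExpectation.
Variables (L : eqType) (q : {ffun I -> T} -> L).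

Lemma cE_measurable f : measurable_for q (cE q f).
Proof. by move=> x y qxy; rewrite /cE qxy. Qed.

Lemma cE_depends_on e f : depends_on e q -> depends_on e (cE q f).
Proof. by move=> qe x y xy; apply: cE_measurable; apply: qe. Qed.

Lemma Ex_cE f g : measurable_for q g ->
  Ex (fun x => cE q f x * g x) = Ex (fun x => f x * g x).
Proof.
move=> gq; pose m x := \sum_(y | q y == q x) weight y.
transitivity (\sum_x \sum_(y | q y == q x) weight y * f y * g y * (weight x / m y)).
  apply: eq_bigr => x _; rewrite /cE -/(m x) -[_ / m x * _]mulrA mulrCA mulr_suml.
  apply: eq_bigr => y /eqP qyx; have -> : m x = m y by rewrite /m qyx.
  by rewrite (gq y x qyx); ring.
rewrite (exchange_big_dep predT) //=; apply: eq_bigr => y _.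
rewrite -mulr_sumr -mulr_suml.
have -> : \sum_(x | q y == q x) weight x = m y.
  by apply: eq_bigl => x; rewrite eq_sym.
(* On a fibre of weight zero, [y] itself has weight zero. *)
have [m0|m0] := eqVneq (m y) 0; last by rewrite divff // mulr1 mulrA.
suff -> : weight y = 0 by rewrite !mul0r.
apply: le_anti; rewrite weight_ge0 andbT -m0 /m (bigD1 y) //= lerDl.
by apply: sumr_ge0 => x _; apply: weight_ge0.
Qed.

Lemma le_cE f g x : (forall y, f y <= g y) -> cE q f x <= cE q g x.
Proof.
move=> fg; rewrite ler_wpM2r ?invr_ge0 ?sumr_ge0 // => [y _|]; first exact: weight_ge0.
by apply: ler_sum => y _; rewrite ler_wpM2l ?weight_ge0.
Qed.

Lemma cE_ge0 f x : (forall y, 0 <= f y) -> 0 <= cE q f x.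
Proof.
by move=> f0; rewrite divr_ge0 ?sumr_ge0 // => y _; rewrite ?mulr_ge0 ?weight_ge0.
Qed.

Lemma cE_le1 f x : (forall y, f y <= 1) -> cE q f x <= 1.
Proof.
move=> f1; apply: le_trans (le_cE x f1) _; rewrite /cE.
under eq_bigr do rewrite mulr1.
by have [->|m0] := eqVneq (\sum_(y | q y == q x) weight y) 0; rewrite ?mul0r ?divff.
Qed.

Lemma Ex_cE_sqr f : Ex (fun x => cE q f x ^+ 2) = Ex (fun x => f x * cE q f x).
Proof. by rewrite -(Ex_cE _ (@cE_measurable f)); apply: eq_Ex => x; rewrite expr2. Qed.

Lemma Ex_cE_sqr_le1 f : (forall x, 0 <= f x <= 1) -> Ex (fun x => cE q f x ^+ 2) <= 1.
Proof.
move=> f01; rewrite -[leRHS](Ex_cst 1); apply: le_Ex => x.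
by rewrite expr_le1 ?cE_ge0 ?cE_le1 // => y; case/andP: (f01 y).
Qed.
End ConditionalExpectation.

(** Pythagoras: the coarser conditional expectation is a projection of the
finer one. *)
Lemma Ex_cE_refine (L L' : eqType) (q : {ffun I -> T} -> L)
    (q' : {ffun I -> T} -> L') f : measurable_for q' q ->
  Ex (fun x => (cE q' f x - cE q f x) ^+ 2) =
  Ex (fun x => cE q' f x ^+ 2) - Ex (fun x => cE q f x ^+ 2).
Proof.
move=> qq'; have cross : Ex (fun x => cE q' f x * cE q f x) = Ex (fun x => cE q f x ^+ 2).
  by rewrite Ex_cE_sqr Ex_cE // => x y xy; apply: cE_measurable; apply: qq'.
transitivity (Ex (fun x => cE q' f x ^+ 2 - 2 * (cE q' f x * cE q f x) + cE q f x ^+ 2)).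
  by apply: eq_Ex => x; ring.
by rewrite ExD ExB ExZ cross; ring.
Qed.
End ProductSpace.

(** * Labels, regularity and pseudorandomness *)

Section Labels.
Variables (I T L : finType).
Implicit Types (x y : {ffun I -> T}) (e h : {set I}) (q : {set I} -> {ffun I -> T} -> L).

Definition labelling q := forall h, depends_on h (q h).

(** The joint value of the labels on at most [j] coordinates, all in [e]. The
option type puts the labels that are left out to a constant, so that two points
have the same joint value exactly when they agree on the labels kept. *)
Definition join j e q x : {ffun {set I} -> option L} :=
  [ffun h : {set I} => if (h \subset e) && (#|h| <= j)%N then Some (q h x) else None].

Lemma joinP j e q x y :
  join j e q x = join j e q y <->
  (forall h : {set I}, h \subset e -> (#|h| <= j)%N -> q h x = q h y).
Proof.
split=> [xy h he hj|xy].
  by move/ffunP/(_ h): xy; rewrite !ffunE he hj => -[].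
by apply/ffunP => h; rewrite !ffunE; case: ifP => // /andP[he hj]; rewrite xy.
Qed.

Lemma join_depends_on j e q : labelling q -> depends_on e (join j e q).
Proof.
move=> qP x y xy; apply/joinP => h he _; apply: qP => i ih.
by apply: xy; apply: (subsetP he).
Qed.

End Labels.

Definition refines (I T L L' : finType) (q' : {set I} -> {ffun I -> T} -> L')
    (q : {set I} -> {ffun I -> T} -> L) :=
  forall h, measurable_for (q' h) (q h).

Lemma join_refines (I T L L' : finType) j e (q' : {set I} -> {ffun I -> T} -> L')
    (q : {set I} -> {ffun I -> T} -> L) :
  refines q' q -> measurable_for (join j e q') (join j e q).
Proof. by move=> qq' x y /joinP xy; apply/joinP => h he hj; apply/qq'/xy. Qed.

Section Regularity.
Variables (R : realFieldType) (I : finType).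

(** Closeness in mean square is what energy increment provides; both the
pseudorandomness of the fine labels and their agreement with the coarse ones
follow from it. *)
Definition stable (T K L : finType) (w : I -> T -> R) j (ee : K -> {set I})
    (phi : K -> {ffun I -> T} -> R) (t : R) G (q : {set I} -> {ffun I -> T} -> L) :=
  forall (L' : finType) (q' : {set I} -> {ffun I -> T} -> L'),
    labelling q' -> refines q' q -> (#|L'| <= G)%N -> forall k,
    Ex w (fun x => (cE w (join j (ee k) q') (phi k) x
                  - cE w (join j (ee k) q) (phi k) x) ^+ 2) <= t.

(** A refinement that breaks stability increases, by Pythagoras, one of the mean
squares by more than [t], and decreases none. As their total is at most [#|K|],
this cannot happen [m] times when [#|K| - total < m * t]. The complexity
allowed by [G] may grow with the number of labels reached, since the successive
bounds [M0], [G M0], [G (G M0)], and so on, do not depend on the space. *)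
Lemma energy_increment (j : nat) (t : R) (G : nat -> nat) m : 0 < t -> forall M0,
  exists Mmax, forall (T : finType) (w : I -> T -> R), prob_weights w ->
  forall (K : finType) (ee : K -> {set I}) (phi : K -> {ffun I -> T} -> R),
    (forall k x, 0 <= phi k x <= 1) ->
  forall (L : finType) (q : {set I} -> {ffun I -> T} -> L), labelling q ->
    (#|L| <= M0)%N ->
    #|K|%:R - \sum_k Ex w (fun x => cE w (join j (ee k) q) (phi k) x ^+ 2) < m%:R * t ->
  exists M (L' : finType) (q' : {set I} -> {ffun I -> T} -> L'),
    [/\ (M <= Mmax)%N, (#|L'| <= M)%N, labelling q', refines q' q &
        stable w j ee phi t (G M) q'].
Proof.
move=> t0; elim: m => [|m IHm] M0.
  exists 0%N => T w wP K ee phi phi01 L q _ _; rewrite mul0r ltNge => /negP[].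
  rewrite subr_ge0 -sumr_const; apply: ler_sum => k _.
  exact: Ex_cE_sqr_le1.
have [Mm HM] := IHm (G M0).
exists (maxn M0 Mm) => T w wP K ee phi phi01 L q qP qM0 qE.
have [[L' [q' [k [q'P q'q q'G qk]]]]|st] := EM (exists (L' : finType)
    (q' : {set I} -> {ffun I -> T} -> L') k,
    [/\ labelling q', refines q' q, (#|L'| <= G M0)%N &
    t < Ex w (fun x => (cE w (join j (ee k) q') (phi k) x
                  - cE w (join j (ee k) q) (phi k) x) ^+ 2)]); last first.
  exists M0, L, q; split => //; first exact: leq_maxl.
    by move=> h x y.
  move=> L' q' q'P q'q q'G k; rewrite leNgt; apply/negP => qk.
  by apply: st; exists L', q', k.
have [|M [L'' [q'' [MMm q''M q''P q''q' q''s]]]] :=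
    HM T w wP K ee phi phi01 L' q' q'P q'G; last first.
  exists M, L'', q''; split => //; first exact: leq_trans MMm (leq_maxr _ _).
  by move=> h x y xy; apply/q'q/q''q'.
move: qE; rewrite (bigD1 k) //= [X in _ -> _ - X < _](bigD1 k) //=.
rewrite Ex_cE_refine // in qk; last exact: join_refines.
set S := \sum_(i | _) _; set S' := \sum_(i | _) _.
have SS' : S <= S'.
  apply: ler_sum => i _; rewrite -subr_ge0 -Ex_cE_refine //; last exact: join_refines.
  by apply: Ex_ge0 => // x; rewrite sqr_ge0.
rewrite -natr1 mulrDl mul1r; lra.
Qed.

End Regularity.

Lemma regular_refinement (R : archiRealFieldType) (I : finType) (j : nat) (t : R)
    (G : nat -> nat) (n M0 : nat) : 0 < t ->
  exists Mmax, forall (T : finType) (w : I -> T -> R), prob_weights w ->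
  forall (K : finType) (ee : K -> {set I}) (phi : K -> {ffun I -> T} -> R),
    (#|K| <= n)%N -> (forall k x, 0 <= phi k x <= 1) ->
  forall (L : finType) (q : {set I} -> {ffun I -> T} -> L), labelling q ->
    (#|L| <= M0)%N ->
  exists M (L' : finType) (q' : {set I} -> {ffun I -> T} -> L'),
    [/\ (M <= Mmax)%N, (#|L'| <= M)%N, labelling q', refines q' q &
        stable w j ee phi t (G M) q'].
Proof.
move=> t0; have [Mmax HM] := @energy_increment R I j t G (Num.bound (n%:R / t)) t0 M0.
exists Mmax => T w wP K ee phi Kn phi01 L q qP qM0; apply: HM => //.
apply: (@le_lt_trans _ _ n%:R).
  rewrite lerBlDr (@le_trans _ _ n%:R) ?ler_nat // lerDl sumr_ge0 // => k _.
  by apply: Ex_ge0 => // x; rewrite sqr_ge0.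
by rewrite -ltr_pdivrMr // archi_boundP // divr_ge0 ?ler0n // ltW.
Qed.

Section Residual.
Variables (R : realFieldType) (I T : finType) (w : I -> T -> R).
Hypothesis wP : prob_weights w.

(** Besides labels of order at most [j], a test function may use one event for
each set of coordinates that meets [e] in at most [j] points. Such an event is
not of order at most [j] in general, but becomes so on [e] once the coordinates
outside [e] are fixed. *)
Definition test_for (L : finType) (q : {set I} -> {ffun I -> T} -> L) j (e : {set I})
    (t : {ffun I -> T} -> R) :=
  exists b : {set I} -> {ffun I -> T} -> bool, labelling b /\
  forall x y, (forall h : {set I}, (#|h| <= j)%N -> q h x = q h y) ->
    (forall h : {set I}, (#|h :&: e| <= j)%N -> b h x = b h y) -> t x = t y.

(** The form in which regularity enters the counting argument, where the tests are
products of events of other sets of coordinates. *)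
Definition pseudorandom (L : finType) (q : {set I} -> {ffun I -> T} -> L) j s
    (e : {set I}) (phi : {ffun I -> T} -> R) :=
  forall t, (forall x, `|t x| <= 1) -> test_for q j e t ->
    `|Ex w (fun x => (phi x - cE w (join j e q) phi x) * t x)| <= s.

(** The number of labels after adding to each of [M] labels a copy of the whole
labelling and a family of events, as needed to turn a test function into a
function of the labels. *)
Definition growth (M : nat) := (M * (M ^ #|{set I}| * 2 ^ #|{set I}|))%N.

(** Fix the coordinates outside [e] to those of [y]. A test function then becomes
a function of labels [q'] on at most [j] coordinates in [e], with [q'] refining
[q]. Against functions of [q'], the function [phi] can be replaced by its
conditional expectation given [q'], which by stability is close to the
conditional expectation given [q]. *)
Lemma stable_pseudorandom (K L : finType) j (ee : K -> {set I})
    (phi : K -> {ffun I -> T} -> R) (s : R) M (q : {set I} -> {ffun I -> T} -> L) :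
  0 < s -> labelling q -> (#|L| <= M)%N -> stable w j ee phi (s ^+ 2) (growth M) q ->
  forall k, depends_on (ee k) (phi k) -> pseudorandom q j s (ee k) (phi k).
Proof.
move=> s0 qP qM st k; set e := ee k; set f := phi k => fe t t1 [b [bP tb]].
pose g := cE w (join j e q) f.
have ge : depends_on e g by apply: cE_depends_on; apply: join_depends_on.
rewrite -[cE w (join j e q) f]/g (Ex_splice wP e); apply: le_trans (ler_norm_Ex wP _) _.
rewrite -[leRHS](Ex_cst wP); apply: le_Ex => // y.
have spl (A : Type) (u : {ffun I -> T} -> A) x : depends_on e u -> u (splice e x y) = u x.
  by move=> ue; apply: ue => i ie; rewrite ffunE ie.
under eq_Ex => x do rewrite (spl _ f) // (spl _ g) //.
pose q' (h : {set I}) x := (q h x, ([ffun h' : {set I} => q h' (splice h x y)],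
                         [ffun h' : {set I} => b h' (splice h x y)])).
have q'P : labelling q'.
  move=> h x x' xx'; rewrite /q' (qP h x x' xx').
  have -> : splice h x y = splice h x' y.
    by apply/ffunP => i; rewrite !ffunE; case: ifP => // /xx'.
  by [].
have q'q : refines q' q by move=> h x x' [].
pose g' := cE w (join j e q') f.
(* A label or event on [h] is read off from the new label on the trace [h :&: e]. *)
have t_meas : measurable_for (join j e q') (fun x => t (splice e x y)).
  have trace (h : {set I}) x x' : join j e q' x = join j e q' x' ->
      (#|h :&: e| <= j)%N -> q' (h :&: e) x = q' (h :&: e) x'.
    by move=> /joinP xx' hj; apply: xx' => //; apply: subsetIr.
  move=> x x' xx'; apply: tb => h hj.
    have he : (#|h :&: e| <= j)%N by apply: leq_trans hj; rewrite subset_leq_card ?subsetIl.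
    have [_ /ffunP/(_ h) + _] := trace h x x' xx' he; rewrite !ffunE => E.
    transitivity (q h (splice (h :&: e) x y)); last rewrite E.
      by apply: qP => i ih; rewrite !ffunE !inE ih.
    by apply: qP => i ih; rewrite !ffunE !inE ih.
  have [_ _ /ffunP/(_ h)] := trace h x x' xx' hj; rewrite !ffunE => E.
  transitivity (b h (splice (h :&: e) x y)); last rewrite E.
    by apply: bP => i ih; rewrite !ffunE !inE ih.
  by apply: bP => i ih; rewrite !ffunE !inE ih.
have -> : Ex w (fun x => (f x - g x) * t (splice e x y)) =
          Ex w (fun x => (g' x - g x) * t (splice e x y)).
  under eq_Ex do rewrite mulrBl; rewrite ExB -(Ex_cE wP f t_meas) -ExB.
  by apply: eq_Ex => x; rewrite mulrBl.
apply: le_trans (ler_norm_Ex wP _) _.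
have /(_ _) st' := st _ q' q'P q'q _ k.
have {st'}gg' : Ex w (fun x => (g' x - g x) ^+ 2) <= s ^+ 2.
  apply: st'; rewrite !card_prod !card_ffun card_bool /growth.
  by rewrite leq_mul // leq_mul // leq_exp2r //; apply/card_gt0P; exists set0.
(* The bound of the first moment by the second, from [2 s u <= u ^+ 2 + s ^+ 2]. *)
apply: (@le_trans _ _ (Ex w (fun x => (2 * s)^-1 * ((g' x - g x) ^+ 2 + s ^+ 2)))).
  apply: le_Ex => // x; rewrite normrM.
  apply: (@le_trans _ _ `|g' x - g x|); first by rewrite ler_piMr.
  rewrite mulrC ler_pdivlMr ?mulr_gt0 // -[(g' x - g x) ^+ 2]real_normK ?num_real //.
  have := sqr_ge0 (`|g' x - g x| - s); lra.
rewrite ExZ ExD Ex_cst // mulrC ler_pdivrMr ?mulr_gt0 //; lra.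
Qed.

End Residual.

(** * Counting in a box *)

Section Counting.
Variables (R : realFieldType) (I T L' : finType) (w : I -> T -> R).
Hypothesis wP : prob_weights w.
Variables (p : {set I} -> {ffun I -> T} -> L') (j : nat) (r : R).
Implicit Types (x y : {ffun I -> T}) (e f h : {set I}).

Definition cPr e (b : {ffun I -> T} -> bool) x := cE w (join j e p) (fun y => (b y)%:R) x.

Lemma cPr01 e b x : 0 <= cPr e b x <= 1.
Proof.
by rewrite cE_ge0 ?cE_le1 // => y; rewrite lern1 leq_b1.
Qed.

Lemma cPr_measurable e b : measurable_for (join j setT p) (cPr e b).
Proof.
move=> x y /joinP xy; apply: cE_measurable; apply/joinP => h _ hj.
by apply: xy => //; apply: subsetT.
Qed.

Lemma small_trace e f : (#|f| <= j.+1)%N -> ~~ (f \subset e) -> (#|e :&: f| <= j)%N.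
Proof.
move=> fj fe; rewrite -ltnS; apply: leq_trans fj; apply: proper_card.
rewrite properE subsetIr /=; apply: contra fe => /subsetP fe.
by apply/subsetP => i /fe; rewrite inE => /andP[].
Qed.

Lemma prod01 (s : seq {set I}) (F : {set I} -> R) :
  (forall f, 0 <= F f <= 1) -> 0 <= \prod_(f <- s) F f <= 1.
Proof.
move=> F01; elim: s => [|f s /andP[IH0 IH1]]; first by rewrite big_nil ler01 lexx.
by case/andP: (F01 f) => F0 F1; rewrite big_cons mulr_ge0 //= mulr_ile1.
Qed.

Lemma bool01 (b : bool) : 0 <= (b%:R : R) <= 1.
Proof. by case: b; rewrite ?lexx ler01. Qed.

Lemma norm_le1 (c : R) : 0 <= c <= 1 -> `|c| <= 1.
Proof. by case/andP => c0 c1; rewrite ger0_norm. Qed.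

Lemma mul01 (c c' : R) : 0 <= c <= 1 -> 0 <= c' <= 1 -> 0 <= c * c' <= 1.
Proof. by move=> /andP[c0 c1] /andP[c'0 c'1]; rewrite mulr_ge0 //= mulr_ile1. Qed.

(** Each step exchanges one event [a f] for its conditional probability, which then
joins the weight [W]. The other factors are legitimate tests for [f]: two distinct
sets with at most [j.+1] elements meet in at most [j] points, and so do [e] and [f]
when [f] is not contained in [e]. *)
Lemma replace_factors e (Y : {ffun I -> T} -> bool) (a : {set I} -> {ffun I -> T} -> bool)
    (s : seq {set I}) : depends_on e Y -> labelling a -> uniq s ->
  {in s, forall f, [/\ (#|f| <= j.+1)%N, ~~ (f \subset e) &
                       pseudorandom w p j r f (fun x => (a f x)%:R)]} ->
  forall W, (forall x, 0 <= W x <= 1) -> measurable_for (join j setT p) W ->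
  `|Ex w (fun x => W x * (Y x)%:R * \prod_(f <- s) (a f x)%:R)
    - Ex w (fun x => W x * (Y x)%:R * \prod_(f <- s) cPr f (a f) x)| <= (size s)%:R * r.
Proof.
move=> Ye aP; elim: s => [|f s IHs] /=.
  by move=> _ _ W _ _; under eq_Ex do rewrite big_nil;
     under [in X in _ - X]eq_Ex do rewrite big_nil; rewrite subrr normr0 mul0r.
case/andP=> fs us sP W W01 Wp.
have [fj fe fr] := sP f (mem_head _ _).
have {}IHs := IHs us (fun h hs => sP h (mem_behead (s := f :: s) hs)).
have W'01 x : 0 <= W x * cPr f (a f) x <= 1 by rewrite mul01 ?cPr01.
have W'p : measurable_for (join j setT p) (fun x => W x * cPr f (a f) x).
  by move=> x y xy; rewrite (Wp x y xy) (cPr_measurable _ _ xy).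
pose t x := W x * (Y x)%:R * \prod_(h <- s) (a h x)%:R.
have t1 x : `|t x| <= 1.
  by apply: norm_le1; rewrite !mul01 ?bool01 // prod01 // => h; apply: bool01.
have tf : test_for p j f t.
  exists (fun h => if h == e then Y else a h); split=> [h|x y pxy bxy].
    by case: eqP => [->|_]; [exact: Ye | exact: aP].
  have Wxy : W x = W y by apply: Wp; apply/joinP => h _; apply: pxy.
  have Yxy : Y x = Y y by have := bxy e (small_trace fj fe); rewrite eqxx.
  rewrite /t Wxy Yxy; congr (_ * _); apply: eq_big_seq => h hs.
  have [hj he _] := sP h (mem_behead (s := f :: s) hs).
  have hNe : h != e by apply: contraNneq he => ->.
  suff /bxy : (#|h :&: f| <= j)%N by rewrite (negPf hNe) => ->.
  have [fh|] := boolP (f \subset h); last exact: small_trace.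
  have : f \proper h by rewrite properEneq fh andbT; apply: contraNneq fs => ->.
  by move/proper_card/leq_trans/(_ hj); rewrite (setIidPr fh).
rewrite -natr1 mulrDl mul1r [_ * r + r]addrC.
apply: le_trans (ler_distD (Ex w (fun x => W x * cPr f (a f) x * (Y x)%:R *
  \prod_(h <- s) (a h x)%:R)) _ _) _.
apply: lerD.
  apply: le_trans (fr t t1 tf); rewrite le_eqVlt; apply/orP; left; apply/eqP.
  congr `|_|; rewrite -ExB; apply: eq_Ex => x; rewrite big_cons /t /cPr; ring.
apply: le_trans (IHs _ W'01 W'p); rewrite le_eqVlt; apply/orP; left; apply/eqP.
congr `|_ - _|; apply: eq_Ex => x; rewrite big_cons; ring.
Qed.

Variables (L : finType) (q : {set I} -> {ffun I -> T} -> L) (nu : {set I} -> L).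
Hypothesis qP : labelling q.

Definition cell f x := q f x == nu f.
(** The constraints on the labels inside [e] only, so that this is an [e]-event; the
box itself is the case of the full set. *)
Definition box e x := [forall f : {set I}, (f \subset e) && (#|f| <= j.+1)%N ==> cell f x].

Lemma box_depends_on e : depends_on e (box e).
Proof.
move=> x y xy; apply: eq_forallb => f; case: andP => //= -[fe _].
by rewrite /cell (qP (h := f) (x := x) (y := y)) // => i /(subsetP fe)/xy.
Qed.

Lemma cell_depends_on : labelling cell.
Proof. by move=> f x y xy; rewrite /cell (qP xy). Qed.

Hypothesis cell_pr : forall f, (#|f| <= j.+1)%N ->
  pseudorandom w p j r f (fun x => (cell f x)%:R).

Definition others e := [seq f : {set I} <- enum {set I} | (#|f| <= j.+1)%N && ~~ (f \subset e)].

Lemma box_others e x :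
  (box setT x)%:R = (box e x)%:R * \prod_(f <- others e) (cell f x)%:R :> R.
Proof.
have -> : \prod_(f <- others e) (cell f x)%:R = (all (cell^~ x) (others e))%:R :> R.
  elim: (others e) => [|f s IHs]; first by rewrite big_nil.
  by rewrite big_cons IHs -natrM mulnb.
rewrite -natrM mulnb; congr (nat_of_bool _)%:R; apply/forallP/andP => [bx|[/forallP bx /allP sx] f].
  split; first by apply/forallP => f; apply/implyP => /andP[_ fj];
                  have := bx f; rewrite subsetT fj.
  by apply/allP => f; rewrite mem_filter => /andP[/andP[fj _] _]; have := bx f; rewrite subsetT fj.
apply/implyP => /andP[_ fj]; have [fe|fe] := boolP (f \subset e).
  by have := bx f; rewrite fe fj.
by apply: sx; rewrite mem_filter fj fe mem_enum.
Qed.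

Lemma size_others e : (size (others e) <= #|{set I}|)%N.
Proof. by rewrite size_filter (leq_trans (count_size _ _)) // -cardT. Qed.

Hypothesis r0 : 0 <= r.

(** Once all the factors outside [e] are replaced, the weight depends on labels of
order at most [j] only, so that [Z] can be replaced by its conditional probability
too. *)
Lemma box_count e (Z D : {ffun I -> T} -> bool) : depends_on e Z ->
  pseudorandom w p j r e (fun x => (Z x)%:R) -> measurable_for (join j setT p) D ->
  `|Ex w (fun x => (D x)%:R * (Z x)%:R * \prod_(f <- others e) (cell f x)%:R)
    - Ex w (fun x => (D x)%:R * cPr e Z x * \prod_(f <- others e) cPr f (cell f) x)|
  <= #|{set I}|.+1%:R * r.
Proof.
move=> Ze Zr Dp.
have D01 x : 0 <= ((D x)%:R : R) <= 1 by apply: bool01.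
have Dm : measurable_for (join j setT p) (fun x => (D x)%:R : R).
  by move=> x y /Dp ->.
have sP : {in others e, forall f, [/\ (#|f| <= j.+1)%N, ~~ (f \subset e) &
                       pseudorandom w p j r f (fun x => (cell f x)%:R)]}.
  by move=> f; rewrite mem_filter => /andP[/andP[fj fe] _]; split=> //; apply: cell_pr.
have us : uniq (others e) by rewrite filter_uniq // enum_uniq.
have H1 := replace_factors Ze cell_depends_on us sP D01 Dm.
rewrite -natr1 mulrDl mul1r.
apply: le_trans (ler_distD (Ex w (fun x => (D x)%:R * (Z x)%:R *
  \prod_(f <- others e) cPr f (cell f) x)) _ _) _.
apply: lerD; first by apply: le_trans H1 _; rewrite ler_wpM2r // ler_nat size_others.
pose t x : R := (D x)%:R * \prod_(f <- others e) cPr f (cell f) x.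
have t1 x : `|t x| <= 1.
  by apply: norm_le1; rewrite mul01 // prod01 // => f; apply: cPr01.
have te : test_for p j e t.
  exists (fun _ _ => true); split=> // x y pxy _.
  have xy : join j setT p x = join j setT p y by apply/joinP => h _; apply: pxy.
  by rewrite /t (Dp x y xy); congr (_ * _); apply: eq_bigr => f _; apply: cPr_measurable.
apply: le_trans (Zr t t1 te); rewrite le_eqVlt; apply/orP; left; apply/eqP.
by congr `|_|; rewrite -ExB; apply: eq_Ex => x; rewrite /t /cPr; ring.
Qed.

(** Let [X e] be the weight predicted for the box over [D], with the factors inside [e]
taken together. The part of the box over [D] outside [Ev e] has predicted weight at
most [X e / 2N]. Summed over the [e], these parts fill at most half of the box, up to
errors, and the rest of the box lies in all [Ev e]. So the weight of the box over [D]
is at most about [2 * delta], while it is at least about [theta ^+ N.+1 * Pr w D]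
because each conditional probability in [X set0] is at least [theta] on [D]. *)
Lemma counting d (D : {ffun I -> T} -> bool) (Ev : {set I} -> {ffun I -> T} -> bool)
    (theta delta : R) : 0 <= theta ->
  (forall e : {set I}, (#|e| <= d)%N -> depends_on e (Ev e)) ->
  (forall e : {set I}, (#|e| <= d)%N -> pseudorandom w p j r e (fun x => (box e x)%:R)) ->
  (forall e : {set I}, (#|e| <= d)%N ->
     pseudorandom w p j r e (fun x => (box e x && ~~ Ev e x)%:R)) ->
  measurable_for (join j setT p) D ->
  (forall x, D x -> forall f : {set I}, (#|f| <= j.+1)%N -> theta <= cPr f (cell f) x) ->
  (forall x, D x -> forall e : {set I}, (#|e| <= d)%N -> theta <= cPr e (box e) x /\
     cPr e (fun y => box e y && ~~ Ev e y) x <= (2 * #|{set I}|%:R)^-1 * cPr e (box e) x) ->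
  Pr w (fun x => [forall e : {set I}, (#|e| <= d)%N ==> Ev e x]) <= delta ->
  theta ^+ #|{set I}|.+1 * Pr w D <=
    2 * delta + (4 * #|{set I}|%:R + 1) * (#|{set I}|.+1%:R * r).
Proof.
move=> th0 Eve boxr Br Dp Dcell Dbox Evd.
set N := #|{set I}|; set rr := N.+1%:R * r.
have N0 : 0 < N%:R :> R by rewrite ltr0n; apply/card_gt0P; exists set0.
have k0 : 0 < (2 * N%:R : R)^-1 by rewrite invr_gt0 mulr_gt0.
pose X e := Ex w (fun x => (D x)%:R * cPr e (box e) x * \prod_(f <- others e) cPr f (cell f) x).
pose pc := Pr w (fun x => D x && box setT x).
have pcE e : pc = Ex w (fun x => (D x)%:R * (box e x)%:R * \prod_(f <- others e) (cell f x)%:R).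
  by apply: eq_Ex => x; rewrite -mulrA -box_others -natrM mulnb.
have pX (e : {set I}) : (#|e| <= d)%N -> `|pc - X e| <= rr.
  by move=> ed; rewrite (pcE e); apply: box_count => //; [exact: box_depends_on|exact: boxr].
have rr0 : 0 <= rr by rewrite mulr_ge0.
have k1 : (2 * N%:R : R)^-1 <= 1.
  have : 1 <= N%:R :> R by rewrite ler1n -(ltr0n R).
  by move=> N1; rewrite invf_le1; [lra | rewrite mulr_gt0].
have g0 x e : 0 <= \prod_(f <- others e) cPr f (cell f) x.
  by have /andP[] := @prod01 (others e) (fun f => cPr f (cell f) x) (fun f => cPr01 _ _ _).
have pB (e : {set I}) : (#|e| <= d)%N -> Pr w (fun x => D x && box setT x && ~~ Ev e x) <=
    (2 * N%:R)^-1 * pc + 2 * rr.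
  move=> ed; pose Z x := box e x && ~~ Ev e x.
  have Ze : depends_on e Z.
    by move=> x y xy; rewrite /Z (box_depends_on xy) (Eve e ed x y xy).
  have := box_count Ze (Br e ed) Dp; set lhs := Ex _ _; set rhs := Ex _ _ => ZZ.
  have -> : Pr w (fun x => D x && box setT x && ~~ Ev e x) = lhs.
    apply: eq_Ex => x; have bo := box_others e x.
    rewrite -mulnb -mulnb !natrM bo /Z -mulnb natrM; ring.
  have rX : rhs <= (2 * N%:R)^-1 * X e.
    rewrite -ExZ; apply: le_Ex => // x; rewrite mulrA ler_wpM2r //.
    rewrite [leRHS]mulrCA; have [Dx|_] := boolP (D x); last by rewrite !mul0r.
    by rewrite !mul1r; have [] := Dbox x Dx e ed.
  have kX : (2 * N%:R)^-1 * X e <= (2 * N%:R)^-1 * pc + rr.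
    rewrite -lerBlDl -mulrBr; apply: le_trans (_ : `|pc - X e| <= _); last exact: pX.
    rewrite distrC; apply: le_trans (ler_norm _) _; rewrite normrM gtr0_norm //.
    by rewrite ler_piMl.
  move: ZZ; rewrite -/rr ler_norml => /andP[_]; lra.
have pc_le : pc <= 2 * delta + 4 * N%:R * rr.
  have : pc <= delta + \sum_(e : {set I} | (#|e| <= d)%N)
      Pr w (fun x => D x && box setT x && ~~ Ev e x).
    apply: le_trans (lerD Evd (Pr_exists wP _ _)).
    apply: le_trans (Pr_or wP _ _); apply: (le_Pr wP) => x Dbx.
    have [//|] := boolP [forall e : {set I}, (#|e| <= d)%N ==> Ev e x].
    rewrite negb_forall => /existsP[e]; rewrite negb_imply => /andP[ed ne].
    by apply/orP; right; apply/existsP; exists e; rewrite ed Dbx.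
  move/le_trans => /(_ (delta + N%:R * ((2 * N%:R)^-1 * pc + 2 * rr))) H.
  have {H} : pc <= delta + N%:R * ((2 * N%:R)^-1 * pc + 2 * rr).
    apply: H; rewrite lerD2l; apply: le_trans (ler_sum _ pB) _.
    rewrite sumr_const -[leLHS]mulr_natl ler_wpM2r //; last by rewrite ler_nat max_card.
    by rewrite addr_ge0 ?mulr_ge0 ?(ltW k0) ?Pr_ge0.
  rewrite mulrDr mulrA invfM mulrCA divff ?gt_eqF // mulr1; lra.
apply: (@le_trans _ _ (X set0)).
  rewrite -ExZ; apply: le_Ex => // x.
  have [Dx|_] := boolP (D x); last by rewrite !mul0r mulr0.
  have [|th _] := Dbox x Dx set0; first by rewrite cards0.
  have th1 : theta <= 1 by case/andP: (cPr01 set0 (box set0) x) => _; apply: le_trans.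
  rewrite mul1r mulr1 exprS ler_pM ?exprn_ge0 //.
  apply: le_trans (ler_wiXn2l th0 th1 (size_others set0)) _.
  have : {in others set0, forall f, theta <= cPr f (cell f) x}.
    by move=> f; rewrite mem_filter => /andP[/andP[fj _] _]; apply: Dcell.
  elim: (others set0) => [|f s IHs] sth /=; first by rewrite big_nil.
  rewrite big_cons exprS ler_pM ?exprn_ge0 //; first by apply: sth; rewrite mem_head.
  by apply: IHs => h hs; apply: sth; rewrite inE hs orbT.
have := pX set0; rewrite cards0 => /(_ isT); rewrite ler_norml => /andP[]; lra.
Qed.
End Counting.

(** * Removal of small events *)

Section Markov.
Variables (R : realFieldType) (I T : finType) (w : I -> T -> R).
Hypothesis wP : prob_weights w.
Implicit Types (b c u : {ffun I -> T} -> bool).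

Lemma Pr_small_cE (L : eqType) (p : {ffun I -> T} -> L) b (theta : R) : 0 <= theta ->
  Pr w (fun x => b x && (cE w p (fun y => (b y)%:R) x < theta)) <= theta.
Proof.
move=> th0; pose g := cE w p (fun y => (b y)%:R); pose s x : R := (g x < theta)%R%:R.
have sp : measurable_for p s by move=> x y xy; rewrite /s /g (cE_measurable w _ xy).
apply: (@le_trans _ _ (Ex w (fun x => g x * s x))).
  by rewrite (Ex_cE wP) //; apply: le_Ex => // x; rewrite -mulnb natrM.
rewrite -[leRHS](Ex_cst wP); apply: le_Ex => // x; rewrite /s.
by have [/ltW|] := ltP (g x) theta; rewrite ?mulr1 ?mulr0.
Qed.

(** Markov's inequality for the conditional probability of [b] given [q] and [p]
jointly, which at [x] is the quotient of the two conditional probabilities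
given [p]. *)
Lemma Pr_large_relative_cE (L L' : eqType) (q : {ffun I -> T} -> L)
    (p : {ffun I -> T} -> L') u b (k : R) : 0 < k -> measurable_for q u ->
  Pr w (fun x => u x && (k * cE w p (fun y => (q y == q x)%:R) x <
                         cE w p (fun y => ((q y == q x) && b y)%:R) x))
  <= k^-1 * Pr w (fun x => u x && b x).
Proof.
move=> k0 uq; pose qp x := (q x, p x).
pose g := cE w qp (fun y => (b y)%:R).
have -> : Pr w (fun x => u x && b x) = Ex w (fun x => g x * (u x)%:R).
  rewrite (Ex_cE wP); first by apply: eq_Ex => x; rewrite -mulnb natrM mulrC.
  by move=> x y [xy _]; rewrite (uq x y xy).
rewrite -ExZ; apply: le_Ex => // x.
have g0 : 0 <= g x by apply: cE_ge0 => // y; apply: ler0n.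
case: (u x); last by rewrite !mulr0.
rewrite mulr1 /=; have [|_] := ltP; last by rewrite mulr_ge0 ?invr_ge0 // ltW.
rewrite [leRHS]mulrC ler_pdivlMr // mul1r /cE.
have fib (f : {ffun I -> T} -> R) : \sum_(y | qp y == qp x) weight w y * f y =
    \sum_(y | p y == p x) weight w y * ((q y == q x)%:R * f y).
  rewrite big_mkcond [RHS]big_mkcond; apply: eq_bigr => y _.
  by rewrite xpair_eqE; case: (q y == q x); case: (p y == p x) => //=;
     rewrite ?mul1r ?mul0r ?mulr0.
have -> : g x = (\sum_(y | p y == p x) weight w y * ((q y == q x) && b y)%:R) /
                (\sum_(y | p y == p x) weight w y * (q y == q x)%:R).
  rewrite /g /cE fib; congr (_ / _).
    by apply: eq_bigr => y _; rewrite -mulnb natrM.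
  transitivity (\sum_(y | qp y == qp x) weight w y * 1); last first.
    by rewrite fib; apply: eq_bigr => y _; rewrite mulr1.
  by apply: eq_bigr => y _; rewrite mulr1.
set nB := \sum_(y | _) _ * (_ && _)%:R; set nC := \sum_(y | _) _ * (_ == _)%:R.
set m := \sum_(y | _) _.
have m0 : 0 <= m by apply: sumr_ge0 => y _; apply: weight_ge0.
have nBC : nB <= nC.
  apply: ler_sum => y _; rewrite ler_wpM2l ?weight_ge0 // ler_nat.
  by case: (q y == q x); case: (b y).
have [->|mN0] := eqVneq m 0; first by rewrite !invr0 !mulr0 ltxx.
have mp : 0 < m by rewrite lt_def mN0.
rewrite mulrA ltr_pM2r ?invr_gt0 // => knC.
have nC0 : 0 <= nC by apply: sumr_ge0 => y _; rewrite mulr_ge0 ?weight_ge0.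
have nCp : 0 < nC by apply: lt_le_trans nBC; apply: le_lt_trans knC; rewrite mulr_ge0 // ltW.
by rewrite ler_pdivlMr // ltW.
Qed.

Lemma Pr_far (f g f' g' : {ffun I -> T} -> R) (t c : R) : 0 < c ->
  Ex w (fun x => (f x - f' x) ^+ 2) <= t -> Ex w (fun x => (g x - g' x) ^+ 2) <= t ->
  Pr w (fun x => (c <= `|f x - f' x|) || (c <= `|g x - g' x|)) <= 2 * (t / c ^+ 2).
Proof.
move=> c0 ft gt; apply: le_trans (Pr_or wP _ _) _.
have c2 : 0 < (c ^+ 2)^-1 by rewrite invr_gt0 exprn_gt0.
rewrite [leRHS]mulrDl !mul1r; apply: lerD; apply: le_trans (chebyshev wP _ c0) _;
  by rewrite ler_wpM2r // ltW.
Qed.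
End Markov.

(** The events [F e] are what is left. Removal takes place from the simple events
[U e], so that [Ev e] is used only through the part of [U e] that it fills. *)
Definition removable (R : realFieldType) (I : finType) (d j : nat) (eps d1 : R)
    (M : nat) (delta : R) :=
  forall (T : finType) (w : I -> T -> R), prob_weights w ->
  forall (L : finType) (q : {set I} -> {ffun I -> T} -> L), labelling q ->
    (#|L| <= M)%N ->
  forall U Ev : {set I} -> {ffun I -> T} -> bool,
    (forall e : {set I}, (#|e| <= d)%N -> measurable_for (join j e q) (U e)) ->
    (forall e : {set I}, (#|e| <= d)%N -> depends_on e (Ev e)) ->
    (forall e : {set I}, (#|e| <= d)%N -> Pr w (fun x => U e x && ~~ Ev e x) <= d1) ->
    Pr w (fun x => [forall e : {set I}, (#|e| <= d)%N ==> Ev e x]) <= delta ->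
  exists F : {set I} -> {ffun I -> T} -> bool,
    (forall e : {set I}, (#|e| <= d)%N ->
       depends_on e (F e) /\ Pr w (fun x => U e x && ~~ F e x) <= eps) /\
    forall x, exists2 e : {set I}, (#|e| <= d)%N & ~~ F e x.

Definition removal (R : realFieldType) (I : finType) (d j : nat) :=
  forall eps : R, 0 < eps -> exists2 d1 : R, 0 < d1 & forall M : nat,
  exists2 delta : R, 0 < delta & removable I d j eps d1 M delta.

Lemma exists_min_pos (R : realFieldType) (b : nat -> R) m : (forall n, 0 < b n) ->
  exists2 c, 0 < c & forall n, (n <= m)%N -> c <= b n.
Proof.
move=> b0; elim: m => [|m [c c0 cb]].
  by exists (b 0%N) => // n; rewrite leqn0 => /eqP ->.
exists (Num.min c (b m.+1)); first by rewrite lt_min c0 b0.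
move=> n; rewrite leq_eqVlt => /orP[/eqP ->|]; first by rewrite ge_min lexx orbT.
by rewrite ltnS => /cb; rewrite ge_min => ->.
Qed.

Section Removal.
Variables (I : finType) (d : nat).

(** With labels on the empty set of coordinates only, each [U e] is everything or
nothing. If none were empty then the [Ev e] would all have probability nearly 1, and
so would their intersection. Hence the [U e] already have empty intersection. *)
Lemma removal0 (R : realFieldType) : removal R I d 0.
Proof.
move=> eps eps0; set N := #|{set I}|.
have N0 : 0 < N%:R :> R by rewrite ltr0n; apply/card_gt0P; exists set0.
exists (4 * N%:R)^-1; first by rewrite invr_gt0 mulr_gt0.
move=> M; exists 2^-1; first by rewrite invr_gt0.
move=> T w wP L q qP _ U Ev Uq Eve UEv Evd; exists U; split.
  move=> e ed; split.
    by move=> x y xy; apply: Uq => //; exact: (join_depends_on _ qP xy).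
  rewrite (_ : Pr _ _ = 0) ?ltW // -[RHS](Ex_cst wP 0).
  by apply: eq_Ex => x; rewrite andbN.
move=> x; have [/existsP[e /andP[ed eU]]|/existsPn Ux] :=
  boolP [exists e : {set I}, (#|e| <= d)%N && ~~ U e x]; first by exists e.
have Ut (e : {set I}) y : (#|e| <= d)%N -> U e y.
  move=> ed; have := Ux e; rewrite ed negbK => Uex.
  rewrite (Uq e ed y x) //; apply/joinP => h _; rewrite leqn0 cards_eq0 => /eqP ->.
  by apply: qP => i; rewrite inE.
(* Otherwise each [Ev e] has probability at least [1 - (4 N)^-1]. *)
suff : 1 <= 2^-1 + (4^-1 : R) by lra.
rewrite -[leLHS](Ex_cst wP); apply: le_trans (lerD Evd (lexx _)).
pose bad (e : {set I}) x := U e x && ~~ Ev e x.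
apply: (@le_trans _ _ (Pr w (fun x => [forall e : {set I}, (#|e| <= d)%N ==> Ev e x]) +
    \sum_(e : {set I} | (#|e| <= d)%N) Pr w (bad e))); last first.
  rewrite lerD2l; apply: le_trans (ler_sum _ UEv) _.
  rewrite sumr_const invfM -[leLHS]mulr_natr -mulrA ler_piMr ?invr_ge0 //.
  by rewrite mulrC ler_pdivrMr // mul1r ler_nat max_card.
apply: le_trans (lerD (lexx _) (Pr_exists wP _ _)); apply: le_trans (Pr_or wP _ _).
apply: le_Ex => // y; rewrite ler1n lt0b.
have [//|] := boolP [forall e : {set I}, (#|e| <= d)%N ==> Ev e y].
rewrite negb_forall => /existsP[e]; rewrite negb_imply => /andP[ed ne].
by apply/existsP; exists e; rewrite ed /bad Ut.
Qed.

End Removal.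

Section Step.
Variables (R : archiRealFieldType) (I : finType) (d j : nat).
Hypothesis jd : (j < d)%N.
Local Notation N := (#|{set I}|%:R : R).

(** The events to be regularized, together in one family: [None] stands for a single
label, [Some false] for a box, and [Some true] for the part of a box outside [Ev e]. *)
Definition pieces (T L : finType) (q : {set I} -> {ffun I -> T} -> L)
    (Ev : {set I} -> {ffun I -> T} -> bool)
    (k : {set I} * {ffun {set I} -> L} * option bool) : {ffun I -> T} -> bool :=
  match k.2 with
  | None => cell q k.1.2 k.1.1
  | Some b => fun x => box j q k.1.2 k.1.1 x && (b ==> ~~ Ev k.1.1 x)
  end.

(** The constants are chosen from the coarsest to the finest: [th] is the least relative
size of a box that is worth keeping, and also what may be removed in each of the at
most [m] boxes; [d1] is imposed on the coarse labels by the induction hypothesis and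
is reached by the closeness [t1] of coarse and fine labels; finally [r M'] is the
pseudorandomness of the fine labels when there are [M'] coarse ones. *)
Lemma removal_step : removal R I d j -> removal R I d j.+1.
Proof.
move=> IHj eps eps0.
have N1 : 1 <= N by rewrite ler1n; apply/card_gt0P; exists set0.
have N0 : 0 < N by apply: lt_le_trans N1.
pose k : R := (2 * N)^-1.
have k0 : 0 < k by rewrite invr_gt0 mulr_gt0.
have k1 : k <= 1 by rewrite invf_le1; [lra | rewrite mulr_gt0].
exists (k * eps / 6) => [|M]; first by rewrite divr_gt0 ?mulr_gt0.
pose m := (M ^ #|{set I}|).+1.
have m0 : 0 < m%:R :> R by rewrite ltr0n.
pose th := eps / (3 * m%:R).
have th0 : 0 < th by rewrite divr_gt0 ?mulr_gt0.
have [d1 d10 Hd1] := IHj th th0.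
have /choice[dl dlP] : forall M', exists x : R, 0 < x /\ removable I d j th d1 M' x.
  by move=> M'; have [x x0 Hx] := Hd1 M'; exists x.
have dl0 M' : 0 < dl M' by case: (dlP M').
pose c : R := (th / 2) ^+ #|{set I}|.+1.
have c0 : 0 < c by rewrite exprn_gt0 // divr_gt0.
pose a : R := (4 * N + 1) * #|{set I}|.+1%:R.
have a0 : 0 < a by apply: mulr_gt0; [lra | exact: ltr0Sn].
pose r n := c * dl n / (2 * a).
have r0 M0 : 0 < r M0 by apply: divr_gt0; apply: mulr_gt0.
pose gam := k * th / 4.
have gam0 : 0 < gam by apply: divr_gt0 => //; apply: mulr_gt0.
pose t1 := d1 * gam ^+ 2 / 2.
have t10 : 0 < t1 by apply: divr_gt0 => //; apply: mulr_gt0 => //; apply: exprn_gt0.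
pose n := (#|{set I}| * m * 3)%N.
(* [G M'] bounds the number of fine labels over [M'] coarse ones. The coarse labels are
   required to be stable for refinements of this size. *)
have [G HG] := choice (fun M' => @regular_refinement R I j (r M' ^+ 2) (growth I) n M'
                                  (exprn_gt0 _ (r0 M'))).
have [Mmax HMmax] := @regular_refinement R I j t1 G n 1 t10.
(* The number of coarse labels varies with the space, but is at most [Mmax]. *)
have [delta delta0 Hdelta] := @exists_min_pos R (fun n => c * dl n / 4) Mmax
  (fun n => divr_gt0 (mulr_gt0 c0 (dl0 n)) (ltr0Sn _ _)).
exists delta => // T w wP L q qP LM U Ev Uq Eve UEv Evd.
pose K : finType := ({set I} * {ffun {set I} -> L} * option bool)%type.
pose ee (i : K) := i.1.1; pose phi (i : K) x : R := (pieces q Ev i x)%:R.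
have cardL : (#|{ffun {set I} -> L}| <= m)%N.
  rewrite card_ffun leqW // leq_exp2r //; apply/card_gt0P; exists set0; exact: isT.
have Kn : (#|K| <= n)%N.
  by rewrite !card_prod card_option card_bool leq_mul // leq_mul.
have phi01 i x : 0 <= phi i x <= 1 by apply: bool01.
have [|M' [L1 [p1 [M'max L1M' p1P _ p1st]]]] :=
  HMmax T w wP K ee phi Kn phi01 unit (fun _ _ => tt) (fun _ _ _ _ => erefl).
  by rewrite card_unit.
have [M'' [L2 [p2 [M''G L2M'' p2P p21 p2st]]]] :=
  HG M' T w wP K ee phi Kn phi01 L1 p1 p1P L1M'.
have close := p1st L2 p2 p2P p21 (leq_trans L2M'' M''G).
have pr := stable_pseudorandom wP (r0 M') p2P L2M'' p2st.
pose bb (nu : {ffun {set I} -> L}) e x := box j q nu e x && ~~ Ev e x.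
pose C1 (nu : {ffun {set I} -> L}) e := cPr w p1 j e (box j q nu e).
pose B1 (nu : {ffun {set I} -> L}) e := cPr w p1 j e (bb nu e).
pose C2 (nu : {ffun {set I} -> L}) e := cPr w p2 j e (box j q nu e).
pose B2 (nu : {ffun {set I} -> L}) e := cPr w p2 j e (bb nu e).
(* The coarse event asks for twice as much as the fine one, so that a point in the
   first but not in the second has a conditional probability that changes by [gam]. *)
pose U' nu e x := (th <= C1 nu e x) && (B1 nu e x <= k / 2 * C1 nu e x).
pose E' nu e x := (th / 2 <= C2 nu e x) && (B2 nu e x <= k * C2 nu e x).
have closeC nu e : Ex w (fun x => (C2 nu e x - C1 nu e x) ^+ 2) <= t1.
  have := close (e, nu, Some false); rewrite (_ : phi _ = fun x => (box j q nu e x)%:R) //.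
  by apply: funext => x; rewrite /phi /pieces /= andbT.
have closeB nu e : Ex w (fun x => (B2 nu e x - B1 nu e x) ^+ 2) <= t1.
  exact: close (e, nu, Some true).
have prCell (nu : {ffun {set I} -> L}) f :
    pseudorandom w p2 j (r M') f (fun x => (cell q nu f x)%:R).
  by apply: (pr (f, nu, None)) => x y xy; rewrite /phi /pieces /= (cell_depends_on nu qP xy).
have prC (nu : {ffun {set I} -> L}) e :
    pseudorandom w p2 j (r M') e (fun x => (box j q nu e x)%:R).
  have := pr (e, nu, Some false); rewrite (_ : phi _ = fun x => (box j q nu e x)%:R).
    by apply=> x y xy; rewrite (box_depends_on j nu qP xy).
  by apply: funext => x; rewrite /phi /pieces /= andbT.
have prB (nu : {ffun {set I} -> L}) (e : {set I}) : (#|e| <= d)%N ->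
    pseudorandom w p2 j (r M') e (fun x => (bb nu e x)%:R).
  move=> ed; apply: (pr (e, nu, Some true)) => x y xy.
  by rewrite /phi /pieces /= (box_depends_on j nu qP xy) (Eve e ed x y xy).
have p1dep e : depends_on e (join j e p1) by apply: join_depends_on.
have p2dep e : depends_on e (join j e p2) by apply: join_depends_on.
have nuP nu : exists F : {set I} -> {ffun I -> T} -> bool,
    (forall e : {set I}, (#|e| <= d)%N ->
       depends_on e (F e) /\ Pr w (fun x => U' nu e x && ~~ F e x) <= th) /\
    forall x, exists2 e : {set I}, (#|e| <= d)%N & ~~ F e x.
  apply: ((dlP M').2 T w wP L1 p1 p1P L1M' (U' nu) (E' nu)).
  - move=> e _ x y xy; rewrite /U' /C1 /B1 /cPr.
    by rewrite !(cE_measurable w _ xy).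
  - move=> e _ x y xy; rewrite /E' /C2 /B2 /cPr.
    by rewrite !(cE_measurable w _ (p2dep e x y xy)).
  - move=> e ed; apply: (@le_trans _ _ (2 * (t1 / gam ^+ 2))); last first.
      rewrite le_eqVlt; apply/orP; left; apply/eqP; rewrite /t1; field.
      by rewrite gt_eqF.
    apply: le_trans (Pr_far wP gam0 (closeC nu e) (closeB nu e)).
    apply: (le_Pr wP) => x /andP[/andP[thC BC]]; apply: contraR.
    rewrite negb_or -!ltNge !ltr_norml => /andP[/andP[Cl Cu] /andP[Bl Bu]].
    have kC : k * th <= k * C1 nu e x by rewrite ler_pM2l.
    have kth : k * th <= th by rewrite ler_piMl // ltW.
    have kg : k * (C1 nu e x - gam) <= k * C2 nu e x by rewrite ler_pM2l //; lra.
    have kgam : k * gam <= gam by rewrite ler_piMl // ltW.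
    rewrite mulrBr in kg; apply/andP; rewrite /gam in Cl Cu Bl Bu kg kgam *.
    by split; lra.
  pose D x := [forall e : {set I}, (#|e| <= d)%N ==> E' nu e x].
  have DP x : D x -> forall e : {set I}, (#|e| <= d)%N -> E' nu e x.
    by move=> /forallP Dx e ed; have := Dx e; rewrite ed.
  have th20 : 0 <= th / 2 by lra.
  have := counting wP qP (fun f _ => prCell nu f) (ltW (r0 M')) th20 Eve
    (fun e _ => prC nu e) (prB nu) (D := D) _ _ _ Evd.
  rewrite -/c [_ * (_ * r M')]mulrA -/a => H.
  rewrite -(ler_pM2l c0); apply: le_trans (H _ _ _) _ => {H}.
  - move=> x y xy; apply: eq_forallb => e; congr (_ ==> _); rewrite /E' /C2 /B2.
    by rewrite !(cPr_measurable w _ _ xy).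
  - move=> x Dx f fj; have := DP x Dx f (leq_trans fj jd) => /andP[/le_trans + _]; apply.
    apply: (le_cE wP) => y; rewrite ler_nat; case: (boolP (box _ _ _ _ y)) => // /forallP/(_ f).
    by rewrite subxx fj /= => ->.
  - by move=> x Dx e ed; have /andP[] := DP x Dx e ed.
  have := Hdelta _ M'max; have -> : a * r M' = c * dl M' / 2.
    by rewrite /r; field; rewrite gt_eqF.
  by lra.
have {nuP} [F' F'P] := choice nuP.
exists (fun e x => [forall nu : {ffun {set I} -> L}, box j q nu e x ==> F' nu e x]).
split; last first.
  move=> x; pose nu : {ffun {set I} -> L} := [ffun f => q f x].
  have [e ed nF] := (F'P nu).2 x; exists e => //.
  rewrite negb_forall; apply/existsP; exists nu; rewrite negb_imply nF andbT.
  by apply/forallP => f; apply/implyP => _; rewrite /cell ffunE.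
move=> e ed; split.
  move=> x y xy; apply: eq_forallb => nu; congr (_ ==> _).
    exact: (box_depends_on j nu qP xy).
  exact: ((F'P nu).1 e ed).1.
(* A point lost from [U e] is lost in the removal from [U' nu e], or because its box is
   relatively small, or because [Ev e] does not fill enough of its box. In the third case
   one must not sum over the boxes: their number is unknown when the bound on
   [Pr (U e && ~~ Ev e)] is chosen. *)
pose z1 (nu : {ffun {set I} -> L}) x := U' nu e x && ~~ F' nu e x.
pose z2 (nu : {ffun {set I} -> L}) x := box j q nu e x && (C1 nu e x < th).
pose ce b x := cE w (join j e p1) (fun y => (b y)%:R : R) x.
pose z3 x := U e x && (k / 2 * ce (fun y => join j.+1 e q y == join j.+1 e q x) x <
                       ce (fun y => (join j.+1 e q y == join j.+1 e q x) && ~~ Ev e y) x).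
apply: (@le_trans _ _ (\sum_nu Pr w (z1 nu) + \sum_nu Pr w (z2 nu) + Pr w z3)).
  apply: le_trans (lerD (lerD (Pr_exists wP _ _) (Pr_exists wP _ _)) (lexx _)).
  apply: le_trans (lerD (Pr_or wP _ _) (lexx _)); apply: le_trans (Pr_or wP _ _).
  apply: (le_Pr wP) => x /andP[Ux]; rewrite negb_forall => /existsP[nu].
  rewrite negb_imply => /andP[bx nF].
  have [Clt|Cge] := ltP (C1 nu e x) th.
    by apply/orP; left; apply/orP; right; apply/existsP; exists nu; rewrite /z2 bx Clt.
  have [Ble|Bgt] := leP (B1 nu e x) (k / 2 * C1 nu e x).
    by apply/orP; left; apply/orP; left; apply/existsP; exists nu; rewrite /z1 /U' Cge Ble.
  apply/orP; right; rewrite /z3 Ux /=.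
  have boxE y : box j q nu e y = (join j.+1 e q y == join j.+1 e q x).
    have bxE (h : {set I}) : h \subset e -> (#|h| <= j.+1)%N -> q h x = nu h.
      by move=> he hj; have /forallP/(_ h) := bx; rewrite he hj => /eqP.
    apply/forallP/eqP => [by_ |/joinP yx h].
      apply/joinP => h he hj; rewrite bxE //; have := by_ h; rewrite he hj => /eqP //.
    by apply/implyP => /andP[he hj]; rewrite /cell yx // bxE.
  move: Bgt; rewrite /B1 /C1 /ce /cPr /bb.
  by rewrite (funext boxE).
have sum_th (z : {ffun {set I} -> L} -> {ffun I -> T} -> bool) :
    (forall nu, Pr w (z nu) <= th) -> \sum_nu Pr w (z nu) <= eps / 3.
  move=> zth; apply: le_trans (ler_sum _ (fun nu _ => zth nu)) _.
  rewrite sumr_const -[leLHS]mulr_natl; apply: (@le_trans _ _ (m%:R * th)).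
    by rewrite ler_wpM2r ?ler_nat // ltW.
  by rewrite le_eqVlt; apply/orP; left; apply/eqP; rewrite /th; field; rewrite gt_eqF.
have H1 : \sum_nu Pr w (z1 nu) <= eps / 3.
  by apply: sum_th => nu; have [] := (F'P nu).1 e ed.
have H2 : \sum_nu Pr w (z2 nu) <= eps / 3.
  by apply: sum_th => nu; apply: Pr_small_cE => //; apply: ltW.
have H3 : Pr w z3 <= eps / 3.
  have k20 : 0 < k / 2 by lra.
  apply: le_trans (Pr_large_relative_cE wP (join j e p1) (fun y => ~~ Ev e y) k20 (Uq e ed)) _.
  apply: (@le_trans _ _ ((k / 2)^-1 * (k * eps / 6))).
    by rewrite ler_pM2l ?invr_gt0 //; apply: UEv.
  by rewrite le_eqVlt; apply/orP; left; apply/eqP; field; rewrite gt_eqF.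
lra.
Qed.
End Step.

Lemma removal_all (R : archiRealFieldType) (I : finType) d j :
  (j <= d)%N -> removal R I d j.
Proof.
by elim: j => [_|j IHj jd]; [exact: removal0 | apply: removal_step => //; apply/IHj/ltnW].
Qed.


(** * Simplices as an intersection of facet events *)

Section UniformWeights.
Variables (R : realFieldType) (I T : finType) (X : I -> {set T}).
Hypothesis X0 : forall i, (0 < #|X i|)%N.

Definition uniform i t : R := (t \in X i)%:R / #|X i|%:R.

Lemma uniform_prob : prob_weights uniform.
Proof.
split=> [i t|i]; first by rewrite divr_ge0.
have -> : \sum_t uniform i t = (\sum_(t in X i) 1)%:R / #|X i|%:R.
  rewrite natr_sum [X in X / _]big_mkcond mulr_suml; apply: eq_bigr => t _.
  by rewrite /uniform; case: (t \in X i).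
rewrite sum1_card.
by rewrite divff // pnatr_eq0 -lt0n.
Qed.

Lemma Pr_uniform (b : {ffun I -> T} -> bool) :
  #|[set x : {ffun I -> T} | [forall i, x i \in X i] && b x]|%:R =
  Pr uniform b * \prod_i #|X i|%:R.
Proof.
rewrite mulr_suml -sum1_card natr_sum big_mkcond; apply: eq_bigr => x _.
rewrite inE mulrAC -big_split /=.
have -> : \prod_i (uniform i (x i) * #|X i|%:R) = [forall i, x i \in X i]%:R :> R.
  under eq_bigr => i _ do rewrite divfK ?pnatr_eq0 -?lt0n //.
  case: (boolP [forall i, _]) => [/forallP xX|/forallPn[i xi]].
    by rewrite big1 // => i _; rewrite xX.
  by rewrite (bigD1 i) //= (negPf xi) mul0r.
by rewrite -natrM mulnb; case: (_ && _).
Qed.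

End UniformWeights.

Section Simplices.
Variables (k : nat) (T : finType) (X : 'I_k.+1 -> {set T}) (H : {set {set T}}).
Hypothesis Xdisj : disjoint_classes X.
Implicit Types (x : {ffun 'I_k.+1 -> T}) (i : 'I_k.+1).

Definition facet i x : {set T} := [set x j | j in [set~ i]].

Lemma transversal_inj x : (forall i, x i \in X i) -> injective x.
Proof.
move=> xX i j xij; apply/eqP; apply: contraT => /Xdisj.
by rewrite disjoint_subset => /subsetP/(_ _ (xX i)); rewrite inE xij xX.
Qed.

Lemma is_simplexP x :
  reflect ((forall i, x i \in X i) /\ (forall i, facet i x \in H)) (is_simplex X H x).
Proof.
apply: (iffP andP) => -[xX xH].
  move/forallP in xX; split=> // i; move/forallP/(_ (facet i x)): xH.
  rewrite [facet i x \subset _]imsetS; last by apply/subsetP.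
  by rewrite card_imset ?cardsC1 ?card_ord ?eqxx //; exact: transversal_inj.
have xI := transversal_inj xX; split; first exact/forallP.
apply/forallP => A; apply/implyP => /andP[Ax /eqP Ak].
have AE : x @: (x @^-1: A) = A.
  apply/setP => t; apply/imsetP/idP => [[i]|tA]; first by rewrite inE => + ->.
  by have /imsetP[i _ ti] := subsetP Ax t tA; exists i; rewrite ?inE -?ti.
have : #|~: (x @^-1: A)| = 1%N.
  by rewrite cardsCs setCK card_ord -(card_imset _ xI) AE Ak subSnn.
move/eqP/cards1P => [i iE].
by rewrite -AE -[_ @^-1: _]setCK iE; apply: xH.
Qed.

End Simplices.

Section Main.
Variables (R : realFieldType) (k : nat) (T : finType) (X : 'I_k.+1 -> {set T})
  (H : {set {set T}}).
Hypothesis Xdisj : disjoint_classes X.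
Hypothesis X0 : forall i, (0 < #|X i|)%N.
Implicit Types (x : {ffun 'I_k.+1 -> T}) (i : 'I_k.+1) (e : {set 'I_k.+1}).

(** The condition is void unless [e] omits exactly one index. *)
Definition facet_event e x := [forall i, (e == [set~ i]) ==> (facet i x \in H)].

Lemma facet_event_depends_on e : depends_on e (facet_event e).
Proof.
move=> x y xy; apply: eq_forallb => i; case: eqP => //= ei.
congr (_ \in H); apply: eq_in_imset => l; rewrite -ei; exact: xy.
Qed.

Lemma facet_eventC i x : facet_event [set~ i] x = (facet i x \in H).
Proof.
apply/forallP/idP => [/(_ i)|iH l]; first by rewrite eqxx.
by apply/implyP => /eqP /setC_inj /set1_inj <-.
Qed.

Lemma Pr_facet_events_le (c : R) :
  #|simplices X H|%:R <= c * \prod_i (#|X i|%:R : R) ->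
  Pr (uniform R X) (fun x => [forall e : {set 'I_k.+1}, (#|e| <= k)%N ==> facet_event e x]) <= c.
Proof.
have pX : 0 < \prod_i #|X i|%:R :> R by apply: prodr_gt0 => i _; rewrite ltr0n.
move=> Hc; rewrite -(ler_pM2r pX) -Pr_uniform //; apply: le_trans Hc.
rewrite ler_nat; apply: subset_leq_card; apply/subsetP => x; rewrite !inE.
case/andP => /forallP xX /forallP xe; apply/(is_simplexP H Xdisj); split=> // i.
by have := xe [set~ i]; rewrite cardsC1 card_ord leqnn facet_eventC.
Qed.

Variable F : {set 'I_k.+1} -> {ffun 'I_k.+1 -> T} -> bool.
Hypothesis Fdep : forall e, (#|e| <= k)%N -> depends_on e (F e).

(** Every event [e] that omits [i] is handled by the facet opposite to [i], since the
removal also shrinks events with fewer than [k] coordinates. *)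
Definition bad_below i x :=
  facet_event [set~ i] x &&
  [exists e : {set 'I_k.+1}, (e \subset [set~ i]) && (facet_event e x && ~~ F e x)].

Definition removed i : {set {set T}} :=
  [set facet i x | x in [set x : {ffun 'I_k.+1 -> T} | [forall i, x i \in X i] && bad_below i x]].

Lemma subsetC1_card e i : e \subset [set~ i] -> (#|e| <= k)%N.
Proof. by move/subset_leq_card; rewrite cardsC1 card_ord. Qed.

Lemma removed_sub i : removed i \subset edges_missing X H i.
Proof.
apply/subsetP => A /imsetP[x]; rewrite inE => /andP[/forallP xX /andP[ie _]] ->.
rewrite inE -facet_eventC ie /= disjoint_subset; apply/subsetP => t /imsetP[l].
rewrite !inE => li ->; have /Xdisj := li.
by rewrite disjoint_subset => /subsetP/(_ _ (xX l)); rewrite inE.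
Qed.

(** Changing the coordinate [i] of a bad point leaves it bad. So each removed edge comes
from [#|X i|] bad points at least, one for each value of that coordinate. *)
Lemma card_removed_le (eps : R) i :
  (forall e, (#|e| <= k)%N -> Pr (uniform R X) (fun x => facet_event e x && ~~ F e x) <= eps) ->
  #|removed i|%:R <= #|{set 'I_k.+1}|%:R * eps * \prod_(l | l != i) (#|X l|%:R : R).
Proof.
move=> Feps; have wP := uniform_prob R X0.
set S := [set x : {ffun 'I_k.+1 -> T} | [forall i, x i \in X i] && bad_below i x].
have Sle : (#|removed i| * #|X i| <= #|S|)%N.
  rewrite -cardsX; apply: leq_trans (leq_imset_card (fun x => (facet i x, x i)) (mem S)).
  apply: subset_leq_card; apply/subsetP => -[A t]; rewrite inE /= => /andP[/imsetP[x xS ->] tX].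
  pose x' : {ffun 'I_k.+1 -> T} := [ffun l => if l == i then t else x l].
  have xx' : {in [set~ i], x =1 x'} by move=> l; rewrite !inE ffunE => /negPf ->.
  apply/imsetP; exists x'; last first.
    by rewrite ffunE eqxx; congr (_, _); apply: eq_in_imset.
  move: xS; rewrite !inE => /andP[/forallP xX /andP[ie /existsP[e /andP[ei bad]]]].
  have xx'e : {in e, x =1 x'} by move=> l /(subsetP ei)/xx'.
  apply/andP; split.
    by apply/forallP => l; rewrite ffunE; case: eqP => [->|].
  rewrite /bad_below -(facet_event_depends_on xx') ie; apply/existsP; exists e.
  by rewrite ei -(facet_event_depends_on xx'e) -(Fdep (subsetC1_card ei) xx'e).
have bad_le : Pr (uniform R X) (bad_below i) <= #|{set 'I_k.+1}|%:R * eps.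
  have eps0 : 0 <= eps.
    by apply: le_trans (Feps set0 _); rewrite ?cards0 // Pr_ge0.
  apply: (@le_trans _ _ (\sum_(e : {set 'I_k.+1} | e \subset [set~ i])
      Pr (uniform R X) (fun x => facet_event e x && ~~ F e x))).
    by apply: le_trans (Pr_exists wP _ _); apply: (le_Pr wP) => x /andP[].
  apply: (@le_trans _ _ (\sum_(e : {set 'I_k.+1} | e \subset [set~ i]) eps)).
    by apply: ler_sum => e ei; apply/Feps/(subsetC1_card ei).
  by rewrite sumr_const -[leLHS]mulr_natl ler_wpM2r // ler_nat max_card.
have Xi : 0 < #|X i|%:R :> R by rewrite ltr0n.
rewrite -(ler_pM2l Xi) -natrM; apply: (@le_trans _ _ #|S|%:R); first by rewrite ler_nat mulnC.
rewrite Pr_uniform // (bigD1 i) //= mulrCA ler_pM2l //.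
by rewrite ler_wpM2r // prodr_ge0.
Qed.

(** At a simplex of what is left all facet events hold, but some [F e] fails; the set [e]
omits an index [i], and then the facet opposite to [i] has been removed. *)
Lemma removed_simplex_free :
  (forall x, exists2 e : {set 'I_k.+1}, (#|e| <= k)%N & ~~ F e x) ->
  simplex_free X (H :\: \bigcup_(i < k.+1) removed i).
Proof.
move=> F0 x; apply/negP => /(is_simplexP _ Xdisj)[xX xH].
have {xH}xH i : facet i x \in H /\ facet i x \notin removed i.
  have := xH i; rewrite inE => /andP[/bigcupP nr ->]; split=> //.
  by apply/negP => r; apply: nr; exists i.
have xe e : facet_event e x by apply/forallP => i; apply/implyP => _; have [] := xH i.
have [e ek eF] := F0 x.
have /subsetPn[i _ ie] : ~~ ([set: 'I_k.+1] \subset e).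
  by apply: contraL ek => /subset_leq_card; rewrite cardsT card_ord -ltnNge.
have [_ /negP[]] := xH i; apply/imsetP; exists x => //; rewrite inE.
apply/andP; split; first exact/forallP.
rewrite /bad_below xe; apply/existsP; exists e; rewrite xe eF !andbT.
by apply/subsetP => l le; rewrite !inE; apply: contraNneq ie => <-.
Qed.

End Main.


Unset Implicit Arguments.

Theorem theorem10p1 (R : realType) (k : nat) (hk : (0 < k)%N) (a : R)
    (ha : 0 < a) :
  exists c : R, 0 < c /\
    forall (T : finType) (X : 'I_k.+1 -> {set T}) (H : {set {set T}}),
      disjoint_classes X ->
      partite_hypergraph X H ->
      #|simplices X H|%:R <= c * \prod_(i < k.+1) (#|X i|%:R : R) ->
      exists E : 'I_k.+1 -> {set {set T}},
        (forall i : 'I_k.+1,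
           E i \subset edges_missing X H i /\
           #|E i|%:R <= a * \prod_(j < k.+1 | j != i) (#|X j|%:R : R)) /\
        simplex_free X (H :\: \bigcup_(i < k.+1) E i).
Proof.
have N0 : 0 < #|{set 'I_k.+1}|%:R :> R by rewrite ltr0n; apply/card_gt0P; exists set0.
have [d1 d10 Hd1] := removal_all 'I_k.+1 (leqnn k) (divr_gt0 ha N0).
have [c c0 Hc] := Hd1 2%N; exists c; split=> // T X H Xdisj _ Hsimp.
have [/forallP X0|/forallPn[i]] := boolP [forall i, (0 < #|X i|)%N]; last first.
  rewrite -leqNgt leqn0 cards_eq0 => /eqP Xi; exists (fun=> set0); split.
    by move=> l; rewrite sub0set cards0 mulr_ge0 ?prodr_ge0 // ltW.
  by move=> x; apply/negP => /andP[/forallP/(_ i)]; rewrite Xi inE.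
have [|||||F [Fe F0]] := Hc T (uniform R X) (uniform_prob R X0) bool
  (facet_event H) (@facet_event_depends_on _ _ H) _ (facet_event H) (facet_event H).
- by rewrite card_bool.
- by move=> e ek x y /joinP; apply.
- by move=> e _; apply: facet_event_depends_on.
- move=> e _; rewrite (_ : Pr _ _ = 0) ?ltW // -[RHS](Ex_cst (uniform_prob R X0) 0).
  by apply: eq_Ex => x; rewrite andbN.
- exact: Pr_facet_events_le.
exists (removed X H F); split; last by apply: removed_simplex_free.
move=> i; split; first exact: removed_sub.
have Fdep e ek := (Fe e ek).1; have Feps e ek := (Fe e ek).2.
apply: le_trans (card_removed_le X0 Fdep i Feps) _.
by rewrite mulrCA divff ?mulr1 // gt_eqF.
Qed.
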